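(* $S_3\cong D_6$ is the unique finite dihedral group contained in $\mathcal{C}$. That is, a finite dihedral group $D_{2n}$ belongs to $\mathcal{C}$ if and only if $n=3$.
   Context: $D_{2n}=\langle x,y\mid x^n=y^2=1,\ yxy=x^{-1}\rangle$ denotes the dihedral group of order $2n$. For a finite group $G$, $L(G)$ denotes the set (lattice) of all subgroups of $G$. For $H\in L(G)$, the relative subgroup commutativity degree of $H$ in $G$ is $$sd(H,G)=\frac{1}{|L(H)||L(G)|}\left|\{(H_1,G_1)\in L(H)\times L(G) \mid H_1G_1=G_1H_1\}\right|.$$ Let $f:L(G)\to[0,1]$, $f(H)=sd(H,G)$. The class $\mathcal{C}$ consists of all finite groups $G$ for which $|\mathrm{Im}\, f|=2$, i.e. for which $f$ takes exactly two distinct values. *)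

(* Defs.v *)
From mathcomp Require Import all_boot all_order all_algebra.
From mathcomp Require Import all_fingroup.

Set Implicit Arguments.
Unset Strict Implicit.
Unset Printing Implicit Defensive.

Local Open Scope group_scope.

(* [*] is the product of subsets of gT, so H1 * G1 = G1 * H1 is permutability
   of subgroups, not elementwise commutation. *)
Definition permuting_pairs (gT : finGroupType) (H G : {group gT}) :
    {set {group gT} * {group gT}} :=
  [set p in setX (subgroups H) (subgroups G) | p.1 * p.2 == p.2 * p.1].

(* The degree lies in [0, 1] and is rational by definition, so rat is used for
   the values. *)
Definition sd (gT : finGroupType) (H G : {group gT}) : rat :=
  (#|permuting_pairs H G|%:R / (#|subgroups H| * #|subgroups G|)%:R)%R.

Definition sd_image (gT : finGroupType) (G : {group gT}) : seq rat :=
  undup [seq sd H G | H in subgroups G].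

Definition in_classC (gT : finGroupType) (G : {group gT}) : Prop :=
  size (sd_image G) = 2.

(* For 0 < n the presented group is finite (of order 2n, including n = 1, 2),
   so \isog Grp is isomorphism with it. *)
Definition is_dihedral (n : nat) (gT : finGroupType) (G : {group gT}) : Prop :=
  G \isog Grp (x : y : x ^+ n = y ^+ 2 = 1, y * x * y = x^-1).

(* Main.v *)
(* In the dihedral group G = <x><y> with #[x] = n, every subgroup of <x> is normal,
   so f(H) = 1 - deficit(H) / (|L(H)| |L(G)|), where only the subgroups of H
   outside <x> contribute to the deficit.  If n > 2, then c = c(<y>), the number
   of subgroups not permuting with <y>, is positive (<xy> is one), so f(<y>) < 1
   and membership in the class forces f(H) = f(<y>) whenever f(H) < 1.  For w in
   <x> of prime order p, the subgroup H = <w><y> has p + 3 subgroups, and when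
   all its reflections have the same c the equality f(H) = f(<y>) reads
   2 (c(H) + p c) = (p + 3) c.  This is impossible for p > 3; for p = 3 it gives
   c(H) = 0, and comparing H with <xy> gives n = 3 or 6; for p = 2 it reads
   c = 2 c(H), which fails for n = 6 since then c(H) >= c, for n = 4 since then
   H is normal, and for n = 2^k >= 8 since then c <= c(H) + 2 and c(H) > 2. *)
Require Import Defs.
From mathcomp Require Import all_boot all_order all_algebra.
From mathcomp Require Import all_fingroup all_solvable.
From mathcomp Require Import ring zify.

Set Implicit Arguments.
Unset Strict Implicit.
Unset Printing Implicit Defensive.

(** * Deficits and the values of the degree *)

Section Deficit.
Local Open Scope group_scope.

Definition permuting (gT : finGroupType) (G A : {group gT}) : {set {group gT}} :=
  [set B in subgroups G | A * B == B * A].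

Definition nonpermuting (gT : finGroupType) (G A : {group gT}) :
    {set {group gT}} :=
  subgroups G :\: permuting G A.

Definition deficit (gT : finGroupType) (G H : {group gT}) : nat :=
  \sum_(A in subgroups H) #|nonpermuting G A|.

Variables (gT : finGroupType) (G : {group gT}).
Implicit Types A B H K : {group gT}.

Lemma in_subgroups A B : (A \in subgroups B) = (A \subset B).
Proof. by rewrite inE. Qed.

Lemma nonpermutingP A B :
  reflect (B \subset G /\ A * B <> B * A) (B \in nonpermuting G A).
Proof.
rewrite !inE; case: (B \subset G) => /=; last by right=> -[].
by rewrite andbT; apply: (iffP idP) => [/eqP|[_ /eqP]].
Qed.

Lemma card_subgroups_gt0 H : 0 < #|subgroups H|.
Proof. by apply/card_gt0P; exists H; rewrite in_subgroups. Qed.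

Lemma card_permuting_pairs H :
  (#|permuting_pairs H G| + deficit G H =
   #|subgroups H| * #|subgroups G|)%N.
Proof.
have -> : #|permuting_pairs H G| = (\sum_(A in subgroups H) #|permuting G A|)%N.
  rewrite -sum1_card (eq_bigl (fun p : {group gT} * {group gT} =>
    (p.1 \in subgroups H) && (p.2 \in permuting G p.1))); last first.
    by move=> p; rewrite !inE -andbA.
  rewrite -(pair_big_dep (mem (subgroups H))
    (fun A C : {group gT} => C \in permuting G A) (fun _ _ => 1%N)).
  by apply: eq_bigr => A _; rewrite sum1_card.
rewrite /deficit -big_split -sum_nat_const /=.
apply: eq_bigr => A _; rewrite -(cardsID (permuting G A) (subgroups G)).
congr (_ + _)%N; apply: eq_card => B; rewrite !inE.
by case: (B \subset G).
Qed.

(** Each degree is 1 minus the deficit over [#|subgroups H| * #|subgroups G|]. The factor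
    [#|subgroups G|] is common, and cross-multiplying keeps all later comparisons in [nat]. *)
Lemma sd_eq H K :
  (sd H G == sd K G) =
  (deficit G H * #|subgroups K| == deficit G K * #|subgroups H|)%N.
Proof.
have sdE (L : {group gT}) :
    (sd L G = 1 - (deficit G L)%:R / (#|subgroups L| * #|subgroups G|)%:R)%R.
  rewrite /sd -card_permuting_pairs; set p := #|_|; set d := deficit _ _.
  have: ((p + d)%:R != 0 :> rat)%R.
    rewrite Num.Theory.pnatr_eq0 card_permuting_pairs -lt0n muln_gt0.
    by rewrite !card_subgroups_gt0.
  rewrite GRing.natrD => nz; field; exact: nz.
have nz (L : {group gT}) : ((#|subgroups L|)%:R != 0 :> rat)%R.
  by rewrite Num.Theory.pnatr_eq0 -lt0n card_subgroups_gt0.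
rewrite !sdE (inj_eq (GRing.addrI _)) (inj_eq GRing.oppr_inj) !GRing.natrM.
rewrite GRing.eqr_div ?GRing.mulf_neq0 //.
rewrite !GRing.mulrA (inj_eq (GRing.mulIf (nz G))) -!GRing.natrM.
by rewrite Num.Theory.eqr_nat.
Qed.

Lemma deficit1 : deficit G 1%G = 0%N.
Proof.
apply: big1 => A; rewrite in_subgroups => /trivGP->; apply/eqP.
rewrite cards_eq0; apply/eqP/setP=> B; rewrite in_set0; apply/negP.
by case/nonpermutingP=> _ []; rewrite mul1g mulg1.
Qed.

Lemma mem_sd_image H : H \subset G -> sd H G \in sd_image G.
Proof. by move=> sHG; rewrite mem_undup; apply: image_f; rewrite in_subgroups. Qed.

(** The trivial subgroup has degree 1, which a positive deficit excludes; two such subgroups with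
    distinct degrees would give a third value. *)
Lemma in_classC_deficit_eq H K :
    in_classC G -> H \subset G -> K \subset G ->
    (0 < deficit G H)%N -> (0 < deficit G K)%N ->
  (deficit G H * #|subgroups K| = deficit G K * #|subgroups H|)%N.
Proof.
move=> GC sHG sKG dH dK; apply/eqP; rewrite -sd_eq; apply: contraT => neqHK.
have neq1 L : (0 < deficit G L)%N -> sd L G != sd 1%G G.
  move=> dL; rewrite sd_eq deficit1 mul0n -lt0n muln_gt0 dL.
  exact: card_subgroups_gt0.
suff : (2 < size (sd_image G))%N by rewrite GC.
apply: (@uniq_leq_size _ [:: sd 1%G G; sd H G; sd K G]).
  by rewrite /= !inE negb_or neqHK ![sd 1%G G == _]eq_sym !neq1.
by apply/allP; rewrite /= !mem_sd_image ?sub1G.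
Qed.

Lemma in_classC_deficit_gt0 :
  in_classC G -> exists2 H : {group gT}, H \subset G & (0 < deficit G H)%N.
Proof.
move=> GC; apply/exists_inP; apply: contraT => /exists_inPn d0.
suff : (size (sd_image G) <= 1)%N by rewrite GC.
apply: (@uniq_leq_size _ _ [:: sd 1%G G]); first exact: undup_uniq.
move=> v; rewrite mem_undup => /imageP[H]; rewrite in_subgroups => sHG ->.
have := d0 H sHG; rewrite -leqNgt leqn0 => /eqP dH.
by rewrite inE sd_eq dH deficit1 !mul0n.
Qed.

Lemma two_valued_in_classC H0 :
    H0 \subset G -> (0 < deficit G H0)%N ->
    (forall H, H \subset G -> (0 < deficit G H)%N ->
      (deficit G H * #|subgroups H0| = deficit G H0 * #|subgroups H|)%N) ->
  in_classC G.
Proof.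
move=> sH0G d0 eqd; rewrite /in_classC.
have neq : sd 1%G G != sd H0 G.
  rewrite sd_eq deficit1 mul0n eq_sym -lt0n muln_gt0 d0.
  exact: card_subgroups_gt0.
apply: (@perm_size _ _ [:: sd 1%G G; sd H0 G]).
apply: uniq_perm; rewrite ?undup_uniq //= ?inE ?neq // => v.
rewrite !inE; apply/idP/orP=> [|[] /eqP->]; rewrite ?mem_sd_image ?sub1G //.
rewrite mem_undup => /imageP[H]; rewrite in_subgroups => sHG ->.
have [dH | ] := posnP (deficit G H); last first.
  by move/(eqd H sHG) => e; right; rewrite sd_eq e.
by left; rewrite sd_eq dH deficit1 !mul0n.
Qed.

End Deficit.

(** * Rotations and reflections *)

Section Dihedral.
Local Open Scope group_scope.

Variables (gT : finGroupType) (G : {group gT}) (x y : gT).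
Hypotheses (defG : <[x]> * <[y]> = G) (y2 : y ^+ 2 = 1).
Hypotheses (yNx : y \notin <[x]>) (xy : x ^ y = x^-1).
Implicit Types (A B H : {group gT}) (a b h r s w : gT).

Lemma order_y : #[y] = 2.
Proof.
by apply: nt_prime_order => //; apply: contraNneq yNx => ->; apply: group1.
Qed.

Lemma rot_sub : <[x]> \subset G.
Proof. by rewrite -defG mulG_subl. Qed.

Lemma y_in : y \in G.
Proof. by rewrite -defG (subsetP (mulG_subr <[x]> <[y]>)) ?cycle_id. Qed.

Lemma rotC r s : r \in <[x]> -> s \in <[x]> -> r * s = s * r.
Proof. by case/cycleP=> i -> /cycleP[j ->]; rewrite -!expgD addnC. Qed.

Lemma reflP h : reflect (exists2 r, r \in <[x]> & h = r * y) (h \in G :\: <[x]>).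
Proof.
rewrite inE -defG; apply: (iffP andP) => [[hNx /mulsgP[r s xr]] | [r xr ->]].
  rewrite cycle2g ?order_y // => /set2P[] -> def_h; last by exists r.
  by rewrite def_h mulg1 xr in hNx.
by rewrite groupMl // yNx mem_mulg ?cycle_id.
Qed.

Lemma y_refl : y \in G :\: <[x]>.
Proof. by rewrite inE yNx y_in. Qed.

Lemma rotM_refl r h : r \in <[x]> -> h \in G :\: <[x]> -> r * h \in G :\: <[x]>.
Proof.
move=> xr /reflP[s xs ->]; apply/reflP; exists (r * s); rewrite ?mulgA //.
exact: groupM.
Qed.

Lemma rot_conj r h : r \in <[x]> -> h \in G :\: <[x]> -> r ^ h = r^-1.
Proof.
move=> xr /reflP[s xs ->]; rewrite conjgM (conjgE r s) (rotC xr xs) mulKg.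
by case/cycleP: xr => i ->; rewrite conjXg xy expgVn.
Qed.

Lemma rot_refl r h : r \in <[x]> -> h \in G :\: <[x]> -> r * h = h * r^-1.
Proof. by move=> xr rh; rewrite -(rot_conj xr rh) conjgC. Qed.

Lemma refl_rot r h : r \in <[x]> -> h \in G :\: <[x]> -> h * r = r^-1 * h.
Proof. by move=> xr rh; rewrite [RHS]rot_refl ?groupV // invgK. Qed.

Lemma refl_sq h : h \in G :\: <[x]> -> h * h = 1.
Proof.
case/reflP=> r xr ->; rewrite -mulgA (mulgA y) (refl_rot xr y_refl) -mulgA.
by rewrite (y2 : y * y = 1) mulg1 mulgV.
Qed.

Lemma refl_inv h : h \in G :\: <[x]> -> h^-1 = h.
Proof. by move=> rh; apply/eqP; rewrite eq_invg_mul refl_sq. Qed.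

Lemma refl_mul a b : a \in G :\: <[x]> -> b \in G :\: <[x]> -> a * b \in <[x]>.
Proof.
move=> /reflP[r xr ->] /reflP[s xs ->]; rewrite -mulgA (mulgA y).
by rewrite (refl_rot xs y_refl) -mulgA (y2 : y * y = 1) mulg1 groupM ?groupV.
Qed.

Lemma rot_normal A : A \subset <[x]> -> A <| G.
Proof.
move=> sAx; rewrite /normal (subset_trans sAx rot_sub) /=.
apply/subsetP=> g Gg; rewrite inE; apply/subsetP=> _ /imsetP[r Ar ->].
have xr := subsetP sAx r Ar.
case xg: (g \in <[x]>); first by rewrite conjgE (rotC xr xg) mulKg.
by rewrite (rot_conj xr) ?groupV // inE xg Gg.
Qed.

(** * Permutability and squares of products of reflections *)

Lemma rot_permutes A B : A \subset <[x]> -> B \subset G -> A * B = B * A.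
Proof.
move=> /rot_normal/normal_norm nAG sBG; apply: commute_sym.
by apply: normC; apply: subset_trans nAG.
Qed.

(** Write [b * a = a1 * b1]. As [b * a] is a rotation, [a1] and [b1] are both rotations or both
    reflections. In the first case [a * b] is the inverse of [a1 * b1] and rotations commute; in the
    second [(a * b) ^+ 2 = (a * a1) * (b1 * b)]. *)
Lemma permutes_sq A B a b :
    A \subset G -> B \subset G -> A * B = B * A ->
    a \in A :\: <[x]> -> b \in B :\: <[x]> ->
  (a * b) ^+ 2 \in (A :&: <[x]>) * (B :&: <[x]>).
Proof.
move=> sAG sBG cAB /setDP[Aa aNx] /setDP[Bb bNx].
have ra : a \in G :\: <[x]> by rewrite inE aNx (subsetP sAG).
have rb : b \in G :\: <[x]> by rewrite inE bNx (subsetP sBG).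
have : b * a \in A * B by rewrite cAB mem_mulg.
case/mulsgP=> a1 b1 Aa1 Bb1 def_ba.
have [xa1 | a1Nx] := boolP (a1 \in <[x]>).
  have xb1 : b1 \in <[x]> by rewrite -(groupMl _ xa1) -def_ba refl_mul.
  have -> : a * b = a1^-1 * b1^-1.
    rewrite -[in LHS](refl_inv ra) -[in LHS](refl_inv rb) -invMg def_ba invMg.
    by rewrite rotC ?groupV.
  rewrite expgMn ?mem_mulg //; last by apply: rotC; rewrite groupV.
    by rewrite inE !groupX ?groupV.
  by rewrite inE !groupX ?groupV.
have ra1 : a1 \in G :\: <[x]> by rewrite inE a1Nx (subsetP sAG).
have rb1 : b1 \in G :\: <[x]>.
  rewrite inE (subsetP sBG) // andbT; apply: contra a1Nx => xb1.
  by rewrite -(groupMr _ xb1) -def_ba refl_mul.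
rewrite expgS expg1 !mulgA -(mulgA a) def_ba !mulgA -mulgA mem_mulg //.
  by rewrite inE refl_mul // groupM.
by rewrite inE refl_mul // groupM.
Qed.

(** In fact [a] normalizes [B]: [b ^ a] is [(a * b) ^+ 2 * b^-1], rotations of [B] are inverted by
    [a], and any other element of [B] is a rotation of [B] times [b^-1]. *)
Lemma sq_permutes B a b :
    B \subset G -> a \in G :\: <[x]> -> b \in B :\: <[x]> -> (a * b) ^+ 2 \in B ->
  <[a]> * B = B * <[a]>.
Proof.
move=> sBG ra /setDP[Bb bNx] Bab.
have rb : b \in G :\: <[x]> by rewrite inE bNx (subsetP sBG).
apply: normC; rewrite cycle_subG inE; apply/subsetP=> _ /imsetP[g Bg ->].
have Bba : b ^ a \in B.
  by rewrite -(groupMr _ Bb) conjgE refl_inv //; rewrite expg2 !mulgA in Bab *.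
case xg: (g \in <[x]>); first by rewrite (rot_conj xg) ?groupV.
have xgb : g * b \in <[x]>.
  by rewrite refl_mul // inE xg (subsetP sBG).
rewrite -(mulgK b g) conjMg groupM //; last by rewrite conjVg groupV.
by rewrite (rot_conj xgb) // groupV groupM.
Qed.

(** * Subgroups generated by a rotation and [y] *)

Lemma refl_order a : a \in G :\: <[x]> -> #[a] = 2.
Proof.
move=> ra; apply: nt_prime_order; rewrite ?expg2 ?refl_sq //.
by apply: contraTneq ra => ->; rewrite inE group1.
Qed.

Lemma refl_TI a : a \in G :\: <[x]> -> <[a]> :&: <[x]> = 1.
Proof.
move=> ra; rewrite prime_TIg ?cycle_subG //; first by rewrite -orderE refl_order.
by case/setDP: ra.
Qed.

Lemma rot_joinE w : w \in <[x]> -> <[w]> <*> <[y]> = <[w]> * <[y]>.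
Proof.
move=> xw; rewrite norm_joinEr //.
apply: subset_trans (normal_norm (rot_normal _)); first by rewrite cycle_subG y_in.
by rewrite cycle_subG.
Qed.

Lemma rot_join_sub w : w \in <[x]> -> <[w]> <*> <[y]> \subset G.
Proof.
by move=> xw; rewrite join_subG !cycle_subG y_in (subsetP rot_sub).
Qed.

Lemma rot_joinI w : w \in <[x]> -> (<[w]> <*> <[y]>) :&: <[x]> = <[w]>.
Proof.
move=> xw; rewrite rot_joinE // -group_modl ?cycle_subG //.
by rewrite refl_TI ?y_refl // mulg1.
Qed.

(** Two reflections of [B] differ by a rotation of [B], which is trivial. *)
Lemma refl_cycleE B b :
    B \subset G -> b \in B :\: <[x]> -> B :&: <[x]> = 1 -> B = <[b]>%G.
Proof.
move=> sBG /setDP[Bb bNx] tiB.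
have TI h : h \in B -> h \in <[x]> -> h = 1.
  move=> Bh xh; have : h \in B :&: <[x]> by rewrite inE Bh.
  by rewrite tiB => /set1P.
apply/val_inj/eqP; rewrite eqEsubset cycle_subG Bb andbT.
apply/subsetP=> g Bg; case xg: (g \in <[x]>); first by rewrite (TI g).
have /eqP: g * b = 1.
  apply: TI; first exact: groupM.
  by rewrite refl_mul // inE ?xg ?bNx (subsetP sBG).
by rewrite -eq_invg_mul => /eqP gb; rewrite -groupV gb cycle_id.
Qed.

Lemma y_rot_join w : y \in <[w]> <*> <[y]>.
Proof. by rewrite -cycle_subG joing_subr. Qed.

Lemma rot_join_refl w : w \in <[x]> ->
  (<[w]> <*> <[y]>) :\: <[x]> = [set r * y | r in <[w]>].
Proof.
move=> xw; rewrite rot_joinE //.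
have sw : {subset <[w]> <= <[x]>} by apply/subsetP; rewrite cycle_subG.
apply/setP=> h; rewrite inE; apply/andP/imsetP=> [[hNx] | [r wr ->]].
  case/mulsgP=> r s wr; rewrite cycle2g ?refl_order ?y_refl // => /set2P[] -> def_h.
    by rewrite def_h mulg1 (sw r wr) in hNx.
  by exists r.
by split; [rewrite groupMl ?(sw r) | rewrite mem_mulg ?cycle_id].
Qed.

Lemma card_rot_join_refl w : w \in <[x]> ->
  #|(<[w]> <*> <[y]>) :\: <[x]>| = #[w].
Proof. by move=> xw; rewrite rot_join_refl // card_imset //; apply: mulIg. Qed.

Lemma card_rot_join w : w \in <[x]> -> #|<[w]> <*> <[y]>| = (2 * #[w])%N.
Proof.
move=> xw; rewrite -(cardsID <[x]>) rot_joinI // card_rot_join_refl //.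
by rewrite -orderE mul2n addnn.
Qed.

Lemma rot_join_full : (<[x]> <*> <[y]>)%G = G.
Proof. by apply: val_inj; rewrite /= rot_joinE ?cycle_id. Qed.

(** A subgroup not inside [<[x]>] contains a reflection [b]. Since [#[w]] is prime, it either
    contains [<[w]>], hence is everything, or meets [<[x]>] trivially, hence is [<[b]>]. *)
Lemma big_subgroups_rot_join (F : {group gT} -> nat) w :
    w \in <[x]> -> prime #[w] ->
  \sum_(A in subgroups (<[w]> <*> <[y]>)) F A =
    (F 1%G + F <[w]>%G + F (<[w]> <*> <[y]>)%G
     + \sum_(b in (<[w]> <*> <[y]>) :\: <[x]>) F <[b]>%G)%N.
Proof.
move=> xw pr_w; set H := (<[w]> <*> <[y]>)%G.
have sHG : H \subset G := rot_join_sub xw.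
have reflH b : b \in H :\: <[x]> -> b \in G :\: <[x]>.
  by case/setDP=> Hb bNx; rewrite inE bNx (subsetP sHG).
have -> : subgroups H =
    1%G |: (<[w]>%G |: (H |: [set <[b]>%G | b in H :\: <[x]>])).
  apply/setP=> B; rewrite !inE.
  apply/idP/idP=> [sBH | ]; last first.
    case/or4P=> [/eqP-> | /eqP-> | /eqP-> | /imsetP[b rb ->]] //=.
    - exact: sub1G.
    - exact: joing_subl.
    by rewrite cycle_subG; case/setDP: rb.
  have [sBx | /subsetPn[b Bb bNx]] := boolP (B \subset <[x]>).
    have sBw : B \subset <[w]> by rewrite -(rot_joinI xw) subsetI sBH.
    have := primeP pr_w => -[_ /(_ _ (cardSg sBw))] /pred2P[B1 | Bw].
      by rewrite -val_eqE /= trivg_card1 B1 eqxx.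
    have -> : B = <[w]>%G; last by rewrite eqxx orbT.
    by apply/val_inj/eqP; rewrite eqEcard sBw Bw /= -orderE.
  have rb : b \in H :\: <[x]> by rewrite inE bNx (subsetP sBH).
  have mulB g : g \in H -> g \notin <[x]> -> g * b \in <[w]>.
    move=> Hg gNx; rewrite -(rot_joinI xw) inE groupM // ?(subsetP sBH) //=.
    by rewrite refl_mul ?reflH // inE gNx.
  apply/or4P; have [swB | /(prime_TIg pr_w) tiwB] := boolP (<[w]> \subset B).
    apply: Or43; rewrite -val_eqE /= eqEsubset sBH /=; apply/subsetP=> g Hg.
    case xg: (g \in <[x]>).
      by rewrite (subsetP swB) // -(rot_joinI xw) inE Hg.
    by rewrite -(groupMr _ Bb) (subsetP swB) // mulB ?xg.
  apply: Or44; apply/imsetP; exists b => //.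
  apply: refl_cycleE; rewrite ?(subset_trans sBH) // 1?inE ?bNx //.
  apply/trivgP; rewrite /= -tiwB subsetI subsetIl andbT.
  by apply: subset_trans (setSI _ sBH) _; rewrite /= rot_joinI.
(* What remains is that the listed subgroups are distinct; [b] is recovered from [<[b]>] as its only
   nontrivial element. *)
have wN1 : w != 1 by rewrite -order_gt1 prime_gt1.
have cycN (A : {group gT}) b r :
    b \in H :\: <[x]> -> A = <[b]>%G -> r \in A -> r \in <[x]> -> r = 1.
  move=> /reflH rb -> br xr; have : r \in <[b]> :&: <[x]> by rewrite inE br.
  by rewrite refl_TI // => /set1P.
rewrite !big_setU1 ?big_imset /=; first by rewrite !addnA.
- move=> b c rb rc /(congr1 val) /= eq_bc.
  have : b \in <[c]> by rewrite -eq_bc cycle_id.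
  rewrite cycle2g ?refl_order ?reflH // => /set2P[b1 | //].
  by move: rb; rewrite b1 inE group1.
- apply/imsetP=> -[b rb eqH]; have wH : w \in H by rewrite -cycle_subG joing_subl.
  by rewrite (cycN _ _ _ rb eqH wH xw) eqxx in wN1.
- rewrite !inE negb_or; apply/andP; split.
    apply: contraNneq yNx => /(congr1 val)/= Hw.
    have : y \in <[w]> by rewrite Hw y_rot_join.
    by apply: subsetP; rewrite cycle_subG.
  apply/imsetP=> -[b rb eqw].
  by rewrite (cycN _ _ _ rb eqw (cycle_id w) xw) eqxx in wN1.
rewrite !inE !negb_or; apply/and3P; split.
- by rewrite eq_sym -val_eqE /= cycle_eq1.
- apply: contraNneq yNx => /(congr1 val)/= H1.
  by have := y_rot_join w; rewrite -H1 => /set1P->; apply: group1.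
apply/imsetP=> -[b rb /(congr1 val)/= b1].
have : b \in <[b]> by apply: cycle_id.
by rewrite -b1 => /set1P b_1; move: rb; rewrite b_1 inE group1.
Qed.

(** * Counts of non-permuting subgroups *)

Lemma nonpermuting_normal A : A <| G -> nonpermuting G A = set0.
Proof.
case/andP=> _ nAG; apply/setP=> B; rewrite in_set0.
apply/negP=> /nonpermutingP[sBG []]; apply: commute_sym; apply: normC.
exact: subset_trans nAG.
Qed.

Lemma card_nonpermutingJ A g :
  g \in G -> #|nonpermuting G (A :^ g)%G| = #|nonpermuting G A|.
Proof.
move=> Gg; rewrite -[RHS](card_imset _ (act_inj 'JG g)).
apply: eq_card => B; apply/nonpermutingP/imsetP=> [[sBG cAB] | [C]].
  exists (B :^ g^-1)%G; last by apply: val_inj; rewrite /= conjsgKV.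
  apply/nonpermutingP; split; first by rewrite conj_subG ?groupV.
  move=> cAC; apply: cAB; rewrite /= -[gval B](conjsgKV g) -!conjsMg.
  by rewrite cAC.
case/nonpermutingP=> sCG cAC ->; split; first by rewrite conj_subG.
by rewrite /= -!conjsMg => /(can_inj (conjsgK g)).
Qed.

(** [s ^+ 2 * y] is the conjugate of [y] by [s^-1], and conjugation in [G] preserves the count. *)
Lemma card_nonpermuting_sq s : s \in <[x]> ->
  #|nonpermuting G <[s ^+ 2 * y]>%G| = #|nonpermuting G <[y]>%G|.
Proof.
move=> xs; have Gs : s^-1 \in G by rewrite groupV (subsetP rot_sub).
rewrite -(card_nonpermutingJ <[y]>%G Gs); congr #|nonpermuting _ _|.
apply: val_inj => /=; rewrite -cycleJ; congr <[_]>.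
by rewrite conjgE invgK (refl_rot _ y_refl) ?groupV // invgK mulgA expg2.
Qed.

Lemma subgroups_prime (H : {group gT}) :
  prime #|H| -> subgroups H = [set 1%G; H].
Proof.
move=> prH; apply/setP=> B; rewrite !inE.
apply/idP/orP=> [sBH | [] /eqP-> //]; last exact: sub1G.
have := primeP prH => -[_ /(_ _ (cardSg sBH))] /pred2P[B1 | BH].
  by left; rewrite -val_eqE /= trivg_card1 B1.
by right; rewrite -val_eqE /= eqEcard sBH BH /=.
Qed.

Lemma deficit_refl a : a \in G :\: <[x]> ->
  deficit G <[a]>%G = #|nonpermuting G <[a]>%G| /\ #|subgroups <[a]>%G| = 2.
Proof.
move=> ra; have pr_a : prime #|<[a]>%G| by rewrite -orderE refl_order.
have aN1 : 1%G != <[a]>%G :> {group gT}.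
  by rewrite eq_sym -val_eqE /= trivg_card1 -orderE refl_order.
rewrite /deficit subgroups_prime // cards2 aN1 big_setU1 ?inE // big_set1.
by rewrite nonpermuting_normal ?normal1 // cards0.
Qed.

Lemma deficit_rot_join w : w \in <[x]> -> prime #[w] ->
    {in (<[w]> <*> <[y]>) :\: <[x]>, forall b,
      #|nonpermuting G <[b]>%G| = #|nonpermuting G <[y]>%G|} ->
  deficit G (<[w]> <*> <[y]>)%G =
    (#|nonpermuting G (<[w]> <*> <[y]>)%G| + #[w] * #|nonpermuting G <[y]>%G|)%N
  /\ #|subgroups (<[w]> <*> <[y]>)%G| = #[w].+3.
Proof.
move=> xw prw eq_c; split; last first.
  by rewrite -sum1_card big_subgroups_rot_join // sum1_card card_rot_join_refl.
have c0 A : A \subset <[x]> -> #|nonpermuting G A| = 0%N.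
  by move=> /rot_normal nA; rewrite nonpermuting_normal ?cards0.
rewrite /deficit big_subgroups_rot_join // c0 ?sub1G // c0 ?cycle_subG //.
rewrite !add0n; congr (_ + _)%N; rewrite -(card_rot_join_refl xw) -sum_nat_const.
by apply: eq_bigr => b; apply: eq_c.
Qed.

(** The necessary condition of [permutes_sq] becomes sufficient here: [<[a]>] meets [<[x]>]
    trivially, so the product there reduces to [B :&: <[x]>]. *)
Lemma nonpermuting_reflE a b B :
    a \in G :\: <[x]> -> B \subset G -> b \in B :\: <[x]> ->
  (B \in nonpermuting G <[a]>%G) = ((a * b) ^+ 2 \notin B).
Proof.
move=> ra sBG rb; apply/nonpermutingP/idP=> [[_ cAB] | Bab].
  by apply: contra_notN cAB => Bab; apply: sq_permutes rb Bab.
split=> // cAB; case/negP: Bab.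
have sAG : <[a]> \subset G by rewrite cycle_subG; case/setDP: ra.
have ra' : a \in <[a]> :\: <[x]>.
  by rewrite inE cycle_id andbT; case/setDP: ra.
have := permutes_sq (A := <[a]>%G) sAG sBG cAB ra' rb.
by rewrite /= refl_TI // mul1g => /setIP[].
Qed.

Lemma nonpermuting_refl_ex A B :
  A \subset G -> B \in nonpermuting G A -> exists b, b \in B :\: <[x]>.
Proof.
move=> sAG /nonpermutingP[sBG cAB].
have [sBx | /subsetPn[b Bb bNx]] := boolP (B \subset <[x]>).
  by case: cAB; rewrite (rot_permutes sBx).
by exists b; rewrite inE bNx.
Qed.

Lemma nonpermuting_refl_sub a c :
    a \in G :\: <[x]> -> c \in G :\: <[x]> ->
    {in G :\: <[x]>, forall b, (a * b) ^+ 2 = (c * b) ^+ 2} ->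
  nonpermuting G <[a]>%G \subset nonpermuting G <[c]>%G.
Proof.
move=> ra rc eq_sq; apply/subsetP=> B nB.
have saG : <[a]> \subset G by rewrite cycle_subG; case/setDP: ra.
have sBG : B \subset G by case/nonpermutingP: nB.
have [b rb] := nonpermuting_refl_ex saG nB.
have rGb : b \in G :\: <[x]>.
  by case/setDP: rb => Bb bNx; rewrite inE bNx (subsetP sBG).
by move: nB; rewrite !(nonpermuting_reflE _ sBG rb) // eq_sq.
Qed.

(** [r] commutes with the rotation [y * b] and squares to 1, so [(r * y * b) ^+ 2 = (y * b) ^+ 2]
    and the criterion by squares cannot separate the two reflections. *)
Lemma nonpermuting_invol r :
  r \in <[x]> -> r ^+ 2 = 1 -> nonpermuting G <[r * y]>%G = nonpermuting G <[y]>%G.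
Proof.
move=> xr r2; have rry := rotM_refl xr y_refl.
have eq_sq b : b \in G :\: <[x]> -> (r * y * b) ^+ 2 = (y * b) ^+ 2.
  move=> rb; rewrite -mulgA expgMn ?r2 ?mul1g //.
  by apply: rotC => //; apply: refl_mul => //; apply: y_refl.
apply/eqP; rewrite eqEsubset !nonpermuting_refl_sub ?y_refl // => b rb.
by rewrite eq_sq.
Qed.

(** If the two permuted, [permutes_sq] for the reflections [y] and [r * y] would put
    [(y * r * y) ^+ 2], the inverse of [r ^+ 2], into [<[w]>]. *)
Lemma nonpermuting_rot_join w r :
    w \in <[x]> -> r \in <[x]> -> r ^+ 2 \notin <[w]> ->
  <[r * y]>%G \in nonpermuting G (<[w]> <*> <[y]>)%G.
Proof.
move=> xw xr; apply: contraNT => /nonpermutingP nB.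
have rry := rotM_refl xr y_refl.
have sBG : <[r * y]> \subset G by rewrite cycle_subG; case/setDP: rry.
have cHB : (<[w]> <*> <[y]>) * <[r * y]> = <[r * y]> * (<[w]> <*> <[y]>).
  by apply/eqP; apply: contra_notT nB => /eqP.
have ryH : y \in (<[w]> <*> <[y]>) :\: <[x]> by rewrite inE yNx y_rot_join.
have ryB : r * y \in <[r * y]> :\: <[x]>.
  by rewrite inE cycle_id andbT; case/setDP: rry.
have := permutes_sq (A := (<[w]> <*> <[y]>)%G) (B := <[r * y]>%G)
  (rot_join_sub xw) sBG cHB ryH ryB.
rewrite /= rot_joinI // refl_TI // mulg1 mulgA (refl_rot xr y_refl) -mulgA.
by rewrite (y2 : y * y = 1) mulg1 expgVn groupV.
Qed.

Lemma nonpermuting_y_gt0 : 2 < #[x] -> 0 < #|nonpermuting G <[y]>%G|.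
Proof.
move=> x_gt2; apply/card_gt0P; exists <[x * y]>%G.
(* Seen as the case [w = 1], where the condition becomes [x ^+ 2 != 1]. *)
have -> : <[y]>%G = (<[1]> <*> <[y]>)%G 
  by apply: val_inj; rewrite /= rot_joinE ?group1 // cycle1 mul1g.
apply: nonpermuting_rot_join; rewrite ?group1 ?cycle_id //.
rewrite cycle1; apply/set1P=> /eqP; rewrite -order_dvdn => /(dvdn_leq (ltn0Sn 1)).
by rewrite leqNgt x_gt2.
Qed.

(** * Consequences of membership for odd primes *)

Lemma in_classC_rot_join w :
    in_classC G -> w \in <[x]> -> prime #[w] -> 2 < #[x] ->
    {in (<[w]> <*> <[y]>) :\: <[x]>, forall b,
      #|nonpermuting G <[b]>%G| = #|nonpermuting G <[y]>%G|} ->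
  (2 * (#|nonpermuting G (<[w]> <*> <[y]>)%G| + #[w] * #|nonpermuting G <[y]>%G|)
    = #[w].+3 * #|nonpermuting G <[y]>%G|)%N.
Proof.
move=> GC xw prw x_gt2 eq_c; have c_gt0 := nonpermuting_y_gt0 x_gt2.
have [dH nH] := deficit_rot_join xw prw eq_c.
have [dy ny] := deficit_refl y_refl.
have sHG := rot_join_sub xw.
have syG : <[y]> \subset G by rewrite cycle_subG y_in.
have := in_classC_deficit_eq (H := (<[w]> <*> <[y]>)%G) (K := <[y]>%G) GC sHG syG.
rewrite dH nH dy ny => eqd; rewrite mulnC [RHS]mulnC eqd //.
by rewrite addn_gt0 muln_gt0 c_gt0 (prime_gt0 prw) /= orbT.
Qed.

(** Each [r] in [<[w]>] equals [r ^+ #[w].+1], whose exponent is even; so [r] is a square and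
    [r * y] is conjugate to [y]. *)
Lemma card_nonpermuting_odd w : w \in <[x]> -> odd #[w] ->
  {in (<[w]> <*> <[y]>) :\: <[x]>, forall b,
    #|nonpermuting G <[b]>%G| = #|nonpermuting G <[y]>%G|}.
Proof.
move=> xw odd_w b; rewrite rot_join_refl // => /imsetP[r wr ->].
have rw : r ^+ #[w] = 1.
  by apply/eqP; rewrite -order_dvdn order_dvdG.
have xr : r \in <[x]> by apply: subsetP wr; rewrite cycle_subG.
rewrite -{1}[r](mulg1) -rw -expgS -(odd_double_half #[w].+1) /= odd_w /=.
by rewrite add0n -muln2 expgM; apply: card_nonpermuting_sq; rewrite groupX.
Qed.

Lemma in_classC_odd_prime p : in_classC G -> 2 < #[x] ->
  prime p -> odd p -> p %| #[x] -> #[x] = 3 \/ #[x] = 6.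
Proof.
move=> GC x_gt2 pr_p odd_p p_x; have c_gt0 := nonpermuting_y_gt0 x_gt2.
pose w := x ^+ (#[x] %/ p); have xw : w \in <[x]> by apply: mem_cycle.
have ow : #[w] = p by rewrite orderXdiv ?dvdn_div // divnA // mulKn ?order_gt0.
have := in_classC_rot_join GC xw; rewrite ow => /(_ pr_p x_gt2).
move=> /(_ (card_nonpermuting_odd xw _)); rewrite ow => /(_ odd_p) eq_c.
have p_gt2 : 2 < p by apply: odd_prime_gt2.
(* The equation amounts to [2 * c(H) + (p - 3) * c = 0], with [c > 0] and [p >= 3]. *)
have [p3 cH] : p = 3 /\ #|nonpermuting G (<[w]> <*> <[y]>)%G| = 0%N by nia.
(* As c(H) = 0, [<[x * y]>] permutes with H, which forces this. Then [x ^+ 6 = 1], and 3 and 6 are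
   the divisors of 6 above 2. *)
have : x ^+ 2 \in <[w]>.
  apply: contraT => /(nonpermuting_rot_join xw (cycle_id x)) nxy.
  by rewrite (cards0_eq cH) in_set0 in nxy.
move=> /order_dvdG; rewrite -orderE ow p3 order_dvdn -expgM -order_dvdn.
rewrite dvdn_divisors // !inE => /or4P[] /eqP x_n; rewrite x_n // in x_gt2 *; auto.
Qed.

(** * The involution among the rotations: orders 6, 4 and powers of 2 *)

Lemma invol_rot_uniq z r : z \in <[x]> -> #[z] = 2 -> r \in <[x]> -> r ^+ 2 = 1 ->
  r = 1 \/ r = z.
Proof.
move=> xz oz xr r2; have [-> | rN1] := eqVneq r 1; [by left | right].
have or : #[r] = 2 by apply: nt_prime_order.
have /eqP eq_rz : <[r]> == <[z]>.
  by rewrite (eq_subG_cyclic (cycle_cyclic x)) ?cycle_subG //= -!orderE or oz.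
have := cycle_id r.
by rewrite eq_rz cycle2g // => /set2P[] // r1; rewrite r1 eqxx in rN1.
Qed.

(** The reflections [y] and [z * y] need not be conjugate; the counts agree because the very sets of
    non-permuting subgroups coincide. *)
Lemma card_nonpermuting_klein z : z \in <[x]> -> #[z] = 2 ->
  {in (<[z]> <*> <[y]>) :\: <[x]>, forall b,
    #|nonpermuting G <[b]>%G| = #|nonpermuting G <[y]>%G|}.
Proof.
move=> xz oz b; rewrite rot_join_refl // cycle2g // => /imsetP[r zr ->].
have z2 : z ^+ 2 = 1 by rewrite -oz expg_order.
by case/set2P: zr => ->; rewrite nonpermuting_invol ?group1 ?expg1n.
Qed.

Lemma in_classC_klein z : in_classC G -> 2 < #[x] -> z \in <[x]> -> #[z] = 2 ->
  #|nonpermuting G <[y]>%G| =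
    (2 * #|nonpermuting G (<[z]> <*> <[y]>)%G|)%N.
Proof.
move=> GC x_gt2 xz oz; have := in_classC_rot_join GC xz; rewrite oz.
by move=> /(_ isT x_gt2 (card_nonpermuting_klein xz oz)); lia.
Qed.

Lemma klein_permutes_sq z B b : z \in <[x]> -> #[z] = 2 -> B \subset G ->
    B \notin nonpermuting G (<[z]> <*> <[y]>)%G -> b \in B :\: <[x]> ->
  (y * b) ^+ 2 \in <[z]> * (B :&: <[x]>).
Proof.
move=> xz oz sBG nB rb; have ryH : y \in (<[z]> <*> <[y]>) :\: <[x]>.
  by rewrite inE yNx y_rot_join.
have cHB : (<[z]> <*> <[y]>) * B = B * (<[z]> <*> <[y]>).
  by apply/eqP; apply: contraNT nB => /eqP cHB; apply/nonpermutingP.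
have := permutes_sq (A := (<[z]> <*> <[y]>)%G) (rot_join_sub xz) sBG cHB ryH rb.
by rewrite rot_joinI.
Qed.

Lemma in_classC_neq6 : in_classC G -> #[x] <> 6.
Proof.
move=> GC x6; have x_gt2 : 2 < #[x] by rewrite x6.
have c_gt0 := nonpermuting_y_gt0 x_gt2.
pose z := x ^+ 3; have xz : z \in <[x]> by apply: mem_cycle.
have oz : #[z] = 2 by rewrite orderXdiv x6.
have z4 s : s \in <[z]> -> s ^+ 4 = 1.
  move=> /order_dvdG; rewrite -orderE oz => s2.
  by apply/eqP; rewrite -order_dvdn (dvdn_trans s2).
have syG : <[y]> \subset G by rewrite cycle_subG y_in.
(* This bound contradicts c = 2 c(H), since c is positive. *)
suff : #|nonpermuting G <[y]>%G| <= #|nonpermuting G (<[z]> <*> <[y]>)%G|.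
  by have := in_classC_klein GC x_gt2 xz oz; lia.
apply: subset_leq_card; apply/subsetP=> B nB; apply: contraT => nzB.
have sBG : B \subset G by case/nonpermutingP: nB.
have [b rb] := nonpermuting_refl_ex syG nB.
move: nB; rewrite (nonpermuting_reflE y_refl sBG rb); apply: contraNT => _.
have /mulsgP[s t zs /setIP[Bt xt] def_u] := klein_permutes_sq xz oz sBG nzB rb.
have xu : y * b \in <[x]>.
  by case/setDP: rb => Bb bNx; rewrite refl_mul ?y_refl // inE bNx (subsetP sBG).
have u6 : (y * b) ^+ 6 = 1 by apply/eqP; rewrite -order_dvdn -x6 order_dvdG.
have xs : s \in <[x]> by apply: subsetP zs; rewrite cycle_subG.
(* For [u = y * b], [u ^+ 2 = s * t] and [u ^+ 6 = 1]. Raising [u ^+ 2] to the fourth power kills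
   [s] and, as 8 is 2 modulo 6, leaves [u ^+ 2] unchanged. *)
have -> : (y * b) ^+ 2 = t ^+ 4; last exact: groupX.
rewrite -[LHS]mul1g -{1}u6 -expgD (expgM _ 2 4) def_u.
by rewrite (expgMn _ (rotC xs xt)) z4 ?mul1g.
Qed.

Lemma in_classC_neq4 : in_classC G -> #[x] <> 4.
Proof.
move=> GC x4; have x_gt2 : 2 < #[x] by rewrite x4.
pose z := x ^+ 2; have xz : z \in <[x]> by apply: mem_cycle.
have oz : #[z] = 2 by rewrite orderXdiv x4.
(* This subgroup has order 4 in a group of order 8. Being normal it has c(H) = 0, which forces c =
   0. *)
have nH : (<[z]> <*> <[y]>)%G <| G.
  apply: index2_normal; first exact: rot_join_sub.
  rewrite -divgS ?rot_join_sub //= card_rot_join // oz -rot_join_full /=.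
  by rewrite card_rot_join ?cycle_id // x4.
have := in_classC_klein GC x_gt2 xz oz; rewrite (nonpermuting_normal nH) cards0.
by have := nonpermuting_y_gt0 x_gt2; lia.
Qed.

(** Let [B] permute with [<[z]> <*> <[y]>] but not with [<[y]>], and let [b] be a reflection in [B].
    Then [B] is [<[b]>] and [(y * b) ^+ 2 = z = r ^+ 2], so [y * b] is [r] or [z * r]: at most two
    such [B]. *)
Lemma card_nonpermuting_y_pow2 z r : 2.-nat #[x] ->
    z \in <[x]> -> #[z] = 2 -> r \in <[x]> -> r ^+ 2 = z ->
  #|nonpermuting G <[y]>%G| <=
  #|nonpermuting G (<[z]> <*> <[y]>)%G| + 2.
Proof.
move=> x_nat xz oz xr rz; pose V u := <[y * u]>%G.
have sub : nonpermuting G <[y]>%G \subset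
    nonpermuting G (<[z]> <*> <[y]>)%G :|: [set V r; V (z * r)].
  apply/subsetP=> B nB; rewrite inE; apply/norP=> -[nzB].
  have sBG : B \subset G by case/nonpermutingP: nB.
  have syG : <[y]> \subset G by rewrite cycle_subG y_in.
  have [b rb] := nonpermuting_refl_ex syG nB.
  move: nB; rewrite (nonpermuting_reflE y_refl sBG rb) => uNB.
  have /mulsgP[s t zs Bxt def_u] := klein_permutes_sq xz oz sBG nzB rb.
  have rGB g : g \in B -> g \notin <[x]> -> g \in G :\: <[x]>.
    by move=> Bg gNx; rewrite inE gNx (subsetP sBG).
  have [Bb bNx] := setDP rb.
  have xu : y * b \in <[x]> by rewrite refl_mul ?y_refl ?rGB.
  (* Otherwise Cauchy gives an involution in this 2-group, necessarily [z], and [(y * b) ^+ 2] would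
     lie in [B]. *)
  have tiB : B :&: <[x]> = 1.
    apply/eqP; rewrite trivg_card1; apply: contraNT uNB => oB.
    have : 2 %| #|B :&: <[x]>|.
      have : 2.-nat #|B :&: <[x]>| by apply: pnat_dvd x_nat; rewrite cardSg ?subsetIr.
      by case/p_natP=> -[e | k ->]; [rewrite e in oB | rewrite dvdn_exp].
    case/Cauchy=> // v /setIP[Bv xv] ov.
    have v2 : v ^+ 2 = 1 by rewrite -ov expg_order.
    have vz : v = z.
      have [v1 | //] := invol_rot_uniq xz oz xv v2.
      by rewrite v1 order1 in ov.
    rewrite def_u groupM //; last by case/setIP: Bxt.
    by apply: subsetP zs; rewrite cycle_subG -vz.
  have uz : (y * b) ^+ 2 = z.
    move: Bxt zs; rewrite tiB cycle2g // => /set1P t1 /set2P[] s1.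
      by rewrite def_u t1 s1 mulg1 group1 in uNB.
    by rewrite def_u t1 s1 mulg1.
  have defB : B = <[b]>%G by apply: refl_cycleE.
  case/negP; rewrite !inE defB /V.
  have : (y * b * r^-1) ^+ 2 = 1.
    rewrite expgMn; last by apply: rotC; rewrite ?groupV.
    by rewrite uz expgVn rz mulgV.
  case/(invol_rot_uniq xz oz); first by rewrite groupM ?groupV.
    move/eqP; rewrite -eq_mulgV1 => /eqP <-; apply/orP; left.
    by rewrite -val_eqE /= mulgA (y2 : y * y = 1) mul1g.
  move=> <-; rewrite mulgKV mulgA (y2 : y * y = 1) mul1g; apply/orP; right.
  by rewrite -val_eqE.
apply: leq_trans (subset_leq_card sub) _.
apply: leq_trans (leq_card_setU _ _) _; rewrite leq_add2l cards2.
by case: (_ != _).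
Qed.

(** The witnesses are [<[x ^+ i * y]>] for [i] = 1, 3, 5, distinct because these exponents are below
    [#[x]]. If [x ^+ (2 * i)] were in [<[z]>], then 8 would divide [4 * i] with [i] odd. *)
Lemma card_nonpermuting_klein_pow2 m z : #[x] = (8 * m)%N ->
    z \in <[x]> -> #[z] = 2 ->
  2 < #|nonpermuting G (<[z]> <*> <[y]>)%G|.
Proof.
move=> x_8m xz oz; pose B (j : 'I_3) := <[x ^+ j.*2.+1 * y]>%G.
have m_gt0 : 0 < m by have := order_gt0 x; lia.
have injB : injective B.
  move=> i j /(congr1 val)/= eqB; apply: val_inj.
  have ri : x ^+ i.*2.+1 * y \in G :\: <[x]> by rewrite rotM_refl ?mem_cycle ?y_refl.
  have rj : x ^+ j.*2.+1 * y \in G :\: <[x]> by rewrite rotM_refl ?mem_cycle ?y_refl.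
  have := cycle_id (x ^+ i.*2.+1 * y); rewrite eqB cycle2g ?refl_order //.
  case/set2P=> [e | /mulIg/eqP]; first by move: ri; rewrite e inE group1.
  rewrite eq_expg_mod_order !modn_small; first by move/eqP=> -[/double_inj].
    by case: j {eqB rj} => j /= j_lt3; lia.
  by case: i {eqB ri} => i /= i_lt3; lia.
rewrite -[3]card_ord -(card_imset _ injB); apply: subset_leq_card.
apply/subsetP=> _ /imsetP[j _ ->]; apply: nonpermuting_rot_join => //.
  exact: mem_cycle.
apply/negP=> /order_dvdG; rewrite -orderE oz !order_dvdn -!expgM -order_dvdn x_8m.
by move/(dvdn_trans (dvdn_mulr m (dvdnn 8))); lia.
Qed.

Lemma in_classC_pow2 : in_classC G -> 2 < #[x] -> 2.-nat #[x] -> False.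
Proof.
move=> GC x_gt2 x_nat; have /p_natP[k ok] := x_nat.
case: k ok => [|[|[|k]]] ok; try by rewrite ok in x_gt2.
  exact: in_classC_neq4.
have x_8m : #[x] = (8 * 2 ^ k)%N by rewrite ok !expnS; lia.
(* The exponent gives [r] order 4, so its square is the involution. *)
pose r := x ^+ (2 ^ k.+1); pose z := r ^+ 2.
have xr : r \in <[x]> by apply: mem_cycle.
have xz : z \in <[x]> by apply: groupX.
have oz : #[z] = 2.
  by rewrite /z /r -expgM -expnSr orderXdiv ok ?dvdn_exp2l // expnS mulnK ?expn_gt0.
have := in_classC_klein GC x_gt2 xz oz.
have := card_nonpermuting_klein_pow2 x_8m xz oz.
by have := card_nonpermuting_y_pow2 x_nat xz oz xr (erefl z); lia.
Qed.

(** * The order of [x]: necessity and sufficiency of 3 *)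

Lemma in_classC_order : in_classC G -> 2 < #[x] -> #[x] = 3.
Proof.
move=> GC x_gt2; have [x_nat | ] := boolP (2.-nat #[x]).
  by have := in_classC_pow2 GC x_gt2 x_nat.
rewrite /pnat order_gt0 /= => /allPn[p]; rewrite mem_primes !inE.
case/and3P=> pr_p _ p_x pN2.
have odd_p : odd p by have [p2 | //] := even_prime pr_p; rewrite p2 in pN2.
by have [// | /in_classC_neq6] := in_classC_odd_prime GC x_gt2 pr_p odd_p p_x.
Qed.

(** Subgroups of [<[x]>] have deficit 0. [G] permutes with everything, so its deficit is 3c, over 6
    subgroups; a reflection subgroup has deficit c, over 2 subgroups. Both ratios are c/2. *)
Lemma in_classC_order3 : #[x] = 3 -> in_classC G.
Proof.
move=> x3; have x_gt2 : 2 < #[x] by rewrite x3.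
have pr_x : prime #[x] by rewrite x3.
have c_gt0 := nonpermuting_y_gt0 x_gt2.
have eq_c : {in (<[x]> <*> <[y]>) :\: <[x]>, forall b,
    #|nonpermuting G <[b]>%G| = #|nonpermuting G <[y]>%G|}.
  by apply: card_nonpermuting_odd; rewrite ?cycle_id ?x3.
have [dG nG] := deficit_rot_join (cycle_id x) pr_x eq_c.
rewrite rot_join_full (nonpermuting_normal (normal_refl G)) cards0 add0n x3 in dG.
rewrite rot_join_full x3 in nG.
have syG : <[y]> \subset G by rewrite cycle_subG y_in.
have [dy ny] := deficit_refl y_refl.
apply: (@two_valued_in_classC _ _ <[y]>%G) => // [|H sHG]; rewrite ?dy //.
have [sHx | /subsetPn[b Hb bNx]] := boolP (H \subset <[x]>).
  rewrite /deficit big1 // => A; rewrite in_subgroups => sAH.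
  by rewrite nonpermuting_normal ?cards0 // rot_normal // (subset_trans sAH).
have rb : b \in H :\: <[x]> by rewrite inE bNx.
have rGb : b \in G :\: <[x]> by rewrite inE bNx (subsetP sHG).
have [sxH | /(prime_TIg pr_x) tixH] := boolP (<[x]> \subset H).
  have -> : H = G.
    apply/val_inj/eqP; rewrite eqEsubset sHG /=; apply/subsetP=> g Gg.
    case xg: (g \in <[x]>); first exact: (subsetP sxH).
    by rewrite -(groupMr _ Hb) (subsetP sxH) // refl_mul // inE xg.
  by rewrite dG nG ny; lia.
rewrite (refl_cycleE sHG rb) ?[H :&: _]setIC //.
have [-> ->] := deficit_refl rGb.
by rewrite eq_c ?ny // rot_joinE ?cycle_id // defG.
Qed.

End Dihedral.

(** * The presentation and the symmetric group *)

Section Presentation.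
Local Open Scope group_scope.

Lemma abelian_not_in_classC (gT : finGroupType) (G : {group gT}) :
  abelian G -> ~ in_classC G.
Proof.
move=> abG /in_classC_deficit_gt0[H sHG]; rewrite lt0n => /eqP[].
apply: big1 => A; rewrite in_subgroups => sAH.
rewrite nonpermuting_normal ?cards0 //.
by rewrite -sub_abelian_normal ?(subset_trans sAH).
Qed.

Lemma join_inverted (gT : finGroupType) (x y : gT) :
  x ^ y = x^-1 -> <[x]> <*> <[y]> = <[x]> * <[y]>.
Proof. by move=> xy; rewrite norm_joinEr // cycle_subG inE -cycleJ xy cycleV. Qed.

(** Given [y ^+ 2 = 1], the word [y * x * y] is [x ^ y]; so [y] normalizes [<[x]>] and the generated
    subgroup is a product. *)
Lemma dihedral_relP (gT : finGroupType) (G : {group gT}) (n : nat) :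
  reflect (exists x y : gT,
      [/\ <[x]> * <[y]> = G, x ^+ n = 1, y ^+ 2 = 1 & x ^ y = x^-1])
    (G \homg Grp (x : y : x ^+ n = y ^+ 2 = 1, y * x * y = x^-1)).
Proof.
have conjE (x y : gT) : y ^+ 2 = 1 -> y * x * y = x ^ y.
  move=> y2; suff {1}<- : y^-1 = y by rewrite conjgE mulgA.
  by apply/eqP; rewrite eq_invg_mul; apply/eqP.
apply: (iffP existsP) => [[[x y]] | [x [y [defG xn y2 xy]]]] /=.
  case/eqP=> defG xn y2 yxy; have xy : x ^ y = x^-1 by rewrite -conjE.
  by exists x, y; rewrite -join_inverted.
by exists (x, y); rewrite /= join_inverted // defG xn y2 conjE // xy.
Qed.

Lemma is_dihedral_D (n : nat) : 1 < n -> is_dihedral n [set: 'D_n.*2]%G.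
Proof.
move=> n_gt1 rT H; rewrite (Grp_dihedral n_gt1).
apply/existsP/dihedral_relP => [[[x y] /= /eqP[defH xn y2 xy]] | ].
  by exists x, y; split=> //; rewrite -join_inverted.
case=> x [y [defH xn y2 xy]]; exists (x, y).
by rewrite /= join_inverted // defH xn y2 xy.
Qed.

(** Finite groups with the same presentation are images of each other, so [G] has the order of
    ['D_n.*2]. *)
Lemma card_is_dihedral (n : nat) (gT : finGroupType) (G : {group gT}) :
  1 < n -> is_dihedral n G -> #|G| = n.*2.
Proof.
move=> n_gt1 isoG; rewrite -(card_dihedral n_gt1); apply/card_isog.
rewrite isogEcard (is_dihedral_D n_gt1) (isoGrp_hom isoG) /=.
apply/dvdn_leq/card_homg; rewrite ?cardG_gt0 // isoG.
exact/isoGrp_hom/is_dihedral_D.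
Qed.

Lemma dihedral_S3 : is_dihedral 3 [set: {perm 'I_3}]%G.
Proof.
pose i0 : 'I_3 := ord0; pose i1 : 'I_3 := inord 1; pose i2 : 'I_3 := inord 2.
have i01 : i0 != i1 by rewrite -val_eqE /= inordK.
have i02 : i0 != i2 by rewrite -val_eqE /= inordK.
have i12 : i1 != i2 by rewrite -val_eqE /= !inordK.
pose y := tperm i0 i1; pose t := tperm i1 i2; pose x := y * t.
have yy : y * y = 1 by apply: tperm2.
have y2 : y ^+ 2 = 1 by rewrite expg2.
have xy : x ^ y = x^-1.
  by rewrite conjgE /x invMg !tpermV !mulgA tperm2 mul1g.
have x3 : x ^+ 3 = 1.
  (* Both are the third transposition. This is the braid relation [y * t * y = t * y * t], which
     makes [x ^+ 3] the square of an involution. *)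
  have : t ^ y = y ^ t.
    rewrite tpermJ [RHS]tpermJ tpermR tpermL tpermD // tpermD // eq_sym //.
  rewrite !conjgE !tpermV => yty.
  have -> : x ^+ 3 = (y * (t * y)) * (t * (y * t)).
    by rewrite !expgS expg0 mulg1 /x !mulgA.
  have tt : t * t = 1 by apply: tperm2.
  by rewrite -yty -!mulgA (mulgA y y) yy mul1g (mulgA t t) tt mul1g.
have xN1 : x != 1.
  apply: contra_neq (i12) => x1.
  by rewrite -[RHS]perm1 -x1 /x /y /t permM (tpermD i02 i12) tpermR.
have ox : #[x] = 3 by apply: nt_prime_order.
have oy : #[y] = 2.
  apply: nt_prime_order => //; apply: contra_neq i01 => y1.
  by rewrite -[LHS]perm1 -y1 tpermL.
have coxy : coprime #|<[x]>| #|<[y]>| by rewrite -!orderE ox oy.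
have defS : <[x]> * <[y]> = [set: {perm 'I_3}].
  apply/eqP; rewrite eqEcard subsetT coprime_cardMg // -!orderE ox oy.
  by rewrite cardsT card_Sn.
apply: isoGrp_trans (is_dihedral_D (isT : 1 < 3)).
rewrite isogEcard is_dihedral_D // card_dihedral // cardsT card_Sn andbT.
by apply/dihedral_relP; exists x, y.
Qed.

End Presentation.

Theorem theorem3p3 :
  is_dihedral 3 [set: {perm 'I_3}]%G /\
  forall (n : nat) (gT : finGroupType) (G : {group gT}),
    (0 < n)%N -> is_dihedral n G -> (in_classC G <-> n = 3).
Proof.
split=> [|n gT G n_gt0 isoG].
  exact: dihedral_S3.
have /dihedral_relP[x [y [defG xn y2 xy]]] := isoGrp_hom isoG.
have x_n : #[x]%g %| n by rewrite order_dvdn xn.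
have [n_le2 | n_gt2] := leqP n 2.
  split=> [GC | n3]; last by rewrite n3 in n_le2.
  case: (abelian_not_in_classC _ GC).
  (* Here [n] is 1 or 2; then [x] is its own inverse, so it commutes with [y] and [G] is abelian. *)
  have x2 : (x ^+ 2 = 1)%g.
    apply/eqP; rewrite -order_dvdn (dvdn_trans x_n) //.
    by case: n n_gt0 n_le2 {isoG xn x_n} => [|[|[]]].
  have nxy : y \in 'C(<[x]>)%g.
    rewrite cent_cycle; apply/cent1P; apply: commute_sym; apply/commgP/conjg_fixP.
    by rewrite xy; apply/eqP; rewrite eq_invg_mul; apply/eqP.
  by rewrite -defG abelianM !cycle_abelian cycle_subG.
have leG := card_is_dihedral (ltnW n_gt2) isoG.
have x_le : (#[x]%g <= n)%N by apply: dvdn_leq.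
have y_le : (#[y]%g <= 2)%N by apply: dvdn_leq; rewrite ?order_dvdn ?y2.
have cG : (#|G| * #|(<[x]> :&: <[y]>)%g| = #[x]%g * #[y]%g)%N.
  by rewrite -defG -mul_cardG.
have TI_gt0 : (0 < #|(<[x]> :&: <[y]>)%g|)%N by rewrite cardG_gt0.
(* The order 2n of [G] is the largest that [#[x] <= n] and [#[y] <= 2] allow, so every bound is
   attained. *)
have [ox tixy oy] : [/\ #[x]%g = n, #|(<[x]> :&: <[y]>)%g| = 1%N & #[y]%g = 2].
  by rewrite -muln2 in leG; split; nia.
have yNx : y \notin <[x]>%g.
  apply/negP=> yx; move/eqP: tixy; rewrite -trivg_card1 => /eqP/setP/(_ y).
  rewrite inE yx cycle_id => /esym/set1P y1.
  by rewrite y1 order1 in oy.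
split=> [GC | n3].
  by rewrite -ox; apply: (in_classC_order defG y2 yNx xy GC); rewrite ox.
by apply: (in_classC_order3 defG y2 yNx xy); rewrite ox.
Qed.
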